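(* Let $\varphi_e$ and $\varphi_{e_1}$ form a Mannheim surface offset, with dual Lorentzian offset angle $\bar\theta=\theta+\varepsilon\theta^*$. Then the offset angle $\theta$ and the offset distance $\theta^*$ are given by $$\theta=-s+c,\qquad \theta^*=-\int_0^s\Delta\,du+c^*,$$ respectively, where $c$ and $c^*$ are real constants.
   Context: Minkowski space $\mathbb{R}^3_1$ is $\mathbb{R}^3$ with $\langle \vec a,\vec b\rangle=-a_1b_1+a_2b_2+a_3b_3$, and the Lorentzian cross product is $\vec a\times\vec b=(a_2b_3-a_3b_2,\ a_1b_3-a_3b_1,\ a_2b_1-a_1b_2)$. Dual numbers are $a+\varepsilon a^*$ with $a,a^*\in\mathbb{R}$, $\varepsilon^2=0$; dual vectors are $\vec a+\varepsilon\vec a^*$ with $\vec a,\vec a^*\in\mathbb{R}^3_1$; inner and cross products extend bilinearly over the dual numbers. A differentiable real function $f$ extends to dual numbers by $f(x+\varepsilon x^* )=f(x)+\varepsilon x^*f'(x)$. First surface (spacelike ruled surface): $\varphi_e(s,v)=\vec c(s)+v\,\vec e(s)$ with smooth $\vec c,\vec e$ on an interval containing $0$, $\langle\vec e,\vec e\rangle=1$, $\langle\vec e\,',\vec e\,'\rangle=-1$, $\langle\vec c\,',\vec e\,'\rangle=0$ (prime is $d/ds$; $s$ is the arc-length of the indicatrix $\vec e$, and $\vec c$ is the striction curve). Put $\vec t=\vec e\,'$, $\vec g=-\vec e\times\vec t$, $\Delta=\det(\vec c\,',\vec e,\vec t)$, and $\tilde x=\vec x+\varepsilon\,\vec c\times\vec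 x$ for $\vec x=\vec e,\vec t,\vec g$. The dual arc-length is $\bar s=s+\varepsilon s^*$, $s^*=\int_0^s\Delta\,du$. The dual Darboux frame $\{\tilde e,\tilde t,\tilde g\}$ satisfies $\frac{d\tilde e}{d\bar s}=\tilde t$, $\frac{d\tilde t}{d\bar s}=\tilde e+\bar\gamma\tilde g$, $\frac{d\tilde g}{d\bar s}=\bar\gamma\tilde t$ for a dual function $\bar\gamma$. Second surface (timelike ruled surface with timelike rulings): $\varphi_{e_1}(s_1,v)=\vec c_1(s_1)+v\,\vec e_1(s_1)$ with $\langle\vec e_1,\vec e_1\rangle=-1$, $s_1$ the arc-length of the indicatrix $\vec e_1$, $\vec t_1=\frac{d\vec e_1}{ds_1}$ with $\langle\vec t_1,\vec t_1\rangle=1$, $\langle\frac{d\vec c_1}{ds_1},\vec t_1\rangle=0$ ($\vec c_1$ is the striction curve). Put $\Delta_1=\det(\frac{d\vec c_1}{ds_1},\vec e_1,\vec t_1)$. Its dual arc-length is $\bar s_1=s_1+\varepsilon s_1^*$, $s_1^*=-\int_0^{s_1}\Delta_1du_1$. Its dual Darboux frame is $\{\tilde e_1,\tilde t_1,\tilde g_1\}$, $\tilde x_1=\vec x_1+\varepsilon\,\vec c_1\times\vec x_1$, with $\tilde t_1=\frac{d\tilde e_1}{d\bar s_1}$. Mannheim offsets: $\varphi_e$ and $\varphi_{e_1}$ (with corresponding points, $s_1$ being a regular function of $s$) form a Mannheim surface offset if $\tilde g(\bar s)=\tilde t_1(\bar s_1)$. The frames are then related by $$\tilde e_1=\sinh\bar\theta\,\tilde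 e+\cosh\bar\theta\,\tilde t,\quad \tilde t_1=\tilde g,\quad \tilde g_1=\cosh\bar\theta\,\tilde e+\sinh\bar\theta\,\tilde t,$$ where the dual function $\bar\theta=\theta+\varepsilon\theta^*$ is the dual Lorentzian offset angle; the real functions $\theta$ and $\theta^*$ are called the offset angle and the offset distance. *)

(* Defs.v *)
From Stdlib Require Import Reals.
From Coquelicot Require Import Coquelicot.
Local Open Scope R_scope.

Record vec3 := Vec3 { v1 : R; v2 : R; v3 : R }.

Definition vadd (a b : vec3) : vec3 :=
  Vec3 (v1 a + v1 b) (v2 a + v2 b) (v3 a + v3 b).

Definition vscal (k : R) (a : vec3) : vec3 :=
  Vec3 (k * v1 a) (k * v2 a) (k * v3 a).

Definition vopp (a : vec3) : vec3 := vscal (-1) a.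

(* Minkowski 3-space of signature (-,+,+). *)
Definition ldot (a b : vec3) : R :=
  - v1 a * v1 b + v2 a * v2 b + v3 a * v3 b.

(* With this sign convention, ldot (lcross a b) c = - det3 a b c. *)
Definition lcross (a b : vec3) : vec3 :=
  Vec3 (v2 a * v3 b - v3 a * v2 b)
       (v1 a * v3 b - v3 a * v1 b)
       (v2 a * v1 b - v1 a * v2 b).

Definition det3 (a b c : vec3) : R :=
  v1 a * (v2 b * v3 c - v3 b * v2 c)
  - v2 a * (v1 b * v3 c - v3 b * v1 c)
  + v3 a * (v1 b * v2 c - v2 b * v1 c).

(* The dual number re + eps du, with eps^2 = 0. *)
Record dual := Dual { re : R; du : R }.

(* Extension of a differentiable real function to the dual numbers. *)
Definition dual_ext (f : R -> R) (a : dual) : dual :=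
  Dual (f (re a)) (du a * Derive f (re a)).

(* The dual vector vre + eps vdu. *)
Record dvec3 := DVec3 { vre : vec3; vdu : vec3 }.

Definition dvadd (a b : dvec3) : dvec3 :=
  DVec3 (vadd (vre a) (vre b)) (vadd (vdu a) (vdu b)).

Definition dvscal (k : dual) (a : dvec3) : dvec3 :=
  DVec3 (vscal (re k) (vre a))
        (vadd (vscal (re k) (vdu a)) (vscal (du k) (vre a))).

Definition is_interval (I : R -> Prop) : Prop :=
  forall a b x, I a -> I b -> a <= x <= b -> I x.

(* Functions on an interval I are represented by total functions on R.  I need
   not be open: at an endpoint belonging to I, smoothness means that f is a
   smooth extension to a neighbourhood.  All iterated derivatives are
   required on a neighbourhood because Derive is total, so that existence of
   Derive_n at the single point x would not constrain f near x. *)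
Definition smooth_on (I : R -> Prop) (f : R -> R) : Prop :=
  forall (n : nat) (x : R), I x -> locally x (fun y => ex_derive_n f n y).

Definition vsmooth_on (I : R -> Prop) (f : R -> vec3) : Prop :=
  smooth_on I (fun s => v1 (f s)) /\
  smooth_on I (fun s => v2 (f s)) /\
  smooth_on I (fun s => v3 (f s)).

Definition vderive (f : R -> vec3) (s : R) : vec3 :=
  Vec3 (Derive (fun u => v1 (f u)) s)
       (Derive (fun u => v2 (f u)) s)
       (Derive (fun u => v3 (f u)) s).

(* The ruled surface (s, v) |-> base s + v * ruling s, for s in dom. *)
Record ruled_surface := RuledSurface {
  dom : R -> Prop;
  base : R -> vec3;
  ruling : R -> vec3
}.

(* The vectors t and g of the frame {e, t, g}, where e is the ruling. *)
Definition frame_t (X : ruled_surface) (s : R) : vec3 := vderive (ruling X) s.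

Definition frame_g (X : ruled_surface) (s : R) : vec3 :=
  vopp (lcross (ruling X s) (frame_t X s)).

(* Delta = det (c', e, t). *)
Definition ruled_Delta (X : ruled_surface) (s : R) : R :=
  det3 (vderive (base X) s) (ruling X s) (frame_t X s).

(* The dual vector x + eps (lcross c(s) x), with c the base curve. *)
Definition dual_lift (X : ruled_surface) (s : R) (x : vec3) : dvec3 :=
  DVec3 x (lcross (base X s) x).

Definition dual_e (X : ruled_surface) (s : R) : dvec3 :=
  dual_lift X s (ruling X s).
Definition dual_t (X : ruled_surface) (s : R) : dvec3 :=
  dual_lift X s (frame_t X s).
Definition dual_g (X : ruled_surface) (s : R) : dvec3 :=
  dual_lift X s (frame_g X s).

(* Spacelike ruled surface, parametrized by the arc-length of its indicatrix,
   with the striction curve as base curve. *)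
Record spacelike_ruled (X : ruled_surface) : Prop := {
  sr_interval : is_interval (dom X);
  sr_zero : dom X 0;
  sr_base_smooth : vsmooth_on (dom X) (base X);
  sr_ruling_smooth : vsmooth_on (dom X) (ruling X);
  sr_ruling_unit : forall s, dom X s -> ldot (ruling X s) (ruling X s) = 1;
  sr_arclength : forall s, dom X s -> ldot (frame_t X s) (frame_t X s) = -1;
  sr_striction : forall s, dom X s ->
    ldot (vderive (base X) s) (frame_t X s) = 0
}.

(* Timelike ruled surface with timelike rulings, parametrized by the
   arc-length of its indicatrix, with the striction curve as base curve. *)
Record timelike_ruled (X : ruled_surface) : Prop := {
  tr_interval : is_interval (dom X);
  tr_zero : dom X 0;
  tr_base_smooth : vsmooth_on (dom X) (base X);
  tr_ruling_smooth : vsmooth_on (dom X) (ruling X);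
  tr_ruling_unit : forall s, dom X s -> ldot (ruling X s) (ruling X s) = -1;
  tr_arclength : forall s, dom X s -> ldot (frame_t X s) (frame_t X s) = 1;
  tr_striction : forall s, dom X s ->
    ldot (vderive (base X) s) (frame_t X s) = 0
}.

(* The parameter sigma s of X1 corresponds to the parameter s of X.  Both
   dual frames are viewed as functions of the real parameters, along the dual
   arc-lengths s + eps s^* of the two surfaces. *)
Record mannheim_offset (X X1 : ruled_surface) (sigma : R -> R) : Prop := {
  mo_dom : forall s, dom X s -> dom X1 (sigma s);
  mo_smooth : smooth_on (dom X) sigma;
  mo_regular : forall s, dom X s -> Derive sigma s <> 0;
  mo_mannheim : forall s, dom X s -> dual_g X s = dual_t X1 (sigma s)
}.

Definition dual_offset_angle (X X1 : ruled_surface) (sigma : R -> R)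
    (theta : R -> dual) : Prop :=
  forall s, dom X s ->
    dual_e X1 (sigma s) =
      dvadd (dvscal (dual_ext sinh (theta s)) (dual_e X s))
            (dvscal (dual_ext cosh (theta s)) (dual_t X s)) /\
    dual_t X1 (sigma s) = dual_g X s /\
    dual_g X1 (sigma s) =
      dvadd (dvscal (dual_ext cosh (theta s)) (dual_e X s))
            (dvscal (dual_ext sinh (theta s)) (dual_t X s)).

(* Main.v *)
(** Both claims come from differentiating a scalar function of [s] whose
    values involve only the two surfaces, so no regularity of the offset angle
    or of the offset distance is needed.  Since [<e1, e> = sinh theta] and the
    derivative [sigma' t1 = sigma' g] of [e1] along [sigma] is orthogonal to
    [e], we get [(sinh theta)' = <e1, t> = - cosh theta].  The dual part of the
    relation for [e1] gives [theta^* = <c1 - c, g>], and the dual part of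
    [t1 = g] says that [c1 - c] is parallel to [g], hence orthogonal to [g'];
    as [c1' = sigma' (dc1/ds1)] is orthogonal to [t1 = g], the derivative is
    [- <c', g> = - Delta]. *)
Require Import Defs.
From Stdlib Require Import Reals Lra.
From Coquelicot Require Import Coquelicot.
Local Open Scope R_scope.

(** * Algebra of the Lorentzian scalar and cross products *)

Lemma ldot_sym (a b : vec3) : ldot a b = ldot b a.
Proof. unfold ldot; ring. Qed.

Lemma ldot_vscal_l (k : R) (a b : vec3) : ldot (vscal k a) b = k * ldot a b.
Proof. unfold ldot, vscal; simpl; ring. Qed.

Lemma ldot_vadd_l (a b c : vec3) : ldot (vadd a b) c = ldot a c + ldot b c.
Proof. unfold ldot, vadd; simpl; ring. Qed.

(** Lagrange's identity, with the sign opposite to the Euclidean one. *)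
Lemma ldot_lcross_lcross (a b c d : vec3) :
  ldot (lcross a b) (lcross c d) = ldot a d * ldot b c - ldot a c * ldot b d.
Proof. unfold ldot, lcross; simpl; ring. Qed.

(** * Differentiation of vector-valued functions *)

Definition is_vderive (f : R -> vec3) (x : R) (l : vec3) : Prop :=
  is_derive (fun u => v1 (f u)) x (v1 l) /\
  is_derive (fun u => v2 (f u)) x (v2 l) /\
  is_derive (fun u => v3 (f u)) x (v3 l).

Lemma is_derive_mult_R (f g : R -> R) (x lf lg : R) :
  is_derive f x lf -> is_derive g x lg ->
  is_derive (fun u => f u * g u) x (lf * g x + f x * lg).
Proof.
  intros Hf Hg; exact (is_derive_mult f g x lf lg Hf Hg Rmult_comm).
Qed.

Lemma is_derive_ldot (f g : R -> vec3) (x : R) (lf lg : vec3) :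
  is_vderive f x lf -> is_vderive g x lg ->
  is_derive (fun u => ldot (f u) (g u)) x (ldot lf (g x) + ldot (f x) lg).
Proof.
  intros [Hf1 [Hf2 Hf3]] [Hg1 [Hg2 Hg3]].
  assert (H := is_derive_plus _ _ _ _ _
    (is_derive_plus _ _ _ _ _
      (is_derive_opp _ _ _ (is_derive_mult_R _ _ _ _ _ Hf1 Hg1))
      (is_derive_mult_R _ _ _ _ _ Hf2 Hg2))
    (is_derive_mult_R _ _ _ _ _ Hf3 Hg3)).
  eapply is_derive_ext; [|eapply eq_rect; [exact H|]].
  - intros u; unfold ldot, plus, opp; simpl; ring.
  - unfold ldot, plus, opp; simpl; ring.
Qed.

Lemma is_vderive_opp_lcross (f g : R -> vec3) (x : R) (lf lg : vec3) :
  is_vderive f x lf -> is_vderive g x lg ->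
  is_vderive (fun u => vopp (lcross (f u) (g u))) x
    (vopp (vadd (lcross lf (g x)) (lcross (f x) lg))).
Proof.
  intros [Hf1 [Hf2 Hf3]] [Hg1 [Hg2 Hg3]].
  (* Each component of [vopp (lcross f g)] is -1 times a 2 by 2 minor, so one computation serves all
     three. *)
  assert (minor : forall (a b c d : R -> R) (la lb lc ld : R),
    is_derive a x la -> is_derive b x lb ->
    is_derive c x lc -> is_derive d x ld ->
    is_derive (fun u => -1 * (a u * b u - c u * d u)) x
      (-1 * ((la * b x - lc * d x) + (a x * lb - c x * ld)))).
  { intros a b c d la lb lc ld Ha Hb Hc Hd.
    assert (H := is_derive_minus _ _ _ _ _
      (is_derive_mult_R _ _ _ _ _ Hc Hd) (is_derive_mult_R _ _ _ _ _ Ha Hb)).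
    eapply is_derive_ext; [|eapply eq_rect; [exact H|]].
    - intros u; unfold minus, plus, opp; simpl; ring.
    - unfold minus, plus, opp; simpl; ring. }
  split; [|split]; simpl; apply minor; assumption.
Qed.

Lemma is_vderive_comp (f : R -> vec3) (h : R -> R) (x d : R) (l : vec3) :
  is_vderive f (h x) l -> is_derive h x d ->
  is_vderive (fun u => f (h u)) x (vscal d l).
Proof.
  intros [H1 [H2 H3]] Hh; split; [|split].
  - exact (is_derive_comp (fun u => v1 (f u)) h x _ _ H1 Hh).
  - exact (is_derive_comp (fun u => v2 (f u)) h x _ _ H2 Hh).
  - exact (is_derive_comp (fun u => v3 (f u)) h x _ _ H3 Hh).
Qed.

Lemma smooth_on_ex_derive (I : R -> Prop) (f : R -> R) (x : R) :
  smooth_on I f -> I x -> ex_derive f x.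
Proof. intros Hf Hx; exact (locally_singleton _ _ (Hf 1%nat x Hx)). Qed.

Lemma smooth_on_ex_derive_Derive (I : R -> Prop) (f : R -> R) (x : R) :
  smooth_on I f -> I x -> ex_derive (Derive f) x.
Proof. intros Hf Hx; exact (locally_singleton _ _ (Hf 2%nat x Hx)). Qed.

Lemma vsmooth_on_is_vderive (I : R -> Prop) (f : R -> vec3) (x : R) :
  vsmooth_on I f -> I x -> is_vderive f x (vderive f x).
Proof.
  intros [H1 [H2 H3]] Hx; split; [|split]; apply Derive_correct;
    eapply smooth_on_ex_derive; eassumption.
Qed.

Lemma vsmooth_on_is_vderive_vderive (I : R -> Prop) (f : R -> vec3) (x : R) :
  vsmooth_on I f -> I x -> is_vderive (vderive f) x (vderive (vderive f) x).
Proof.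
  intros [H1 [H2 H3]] Hx; split; [|split]; apply Derive_correct;
    eapply smooth_on_ex_derive_Derive; eassumption.
Qed.

(* [x] may be an endpoint of [I]; the second point [y] of [I] is what makes
   [f] constant on at least one side of [x]. *)
Lemma is_derive_const_on_interval (I : R -> Prop) (f : R -> R) (x y k l : R) :
  is_interval I -> I x -> I y -> y <> x -> (forall z, I z -> f z = k) ->
  is_derive f x l -> l = 0.
Proof.
  intros HI Ix Iy Hyx Hf Hl.
  destruct (Req_dec l 0) as [H0|H0]; [exact H0|exfalso].
  apply is_derive_Reals in Hl.
  (* Difference quotients between points of [I] vanish, so the tolerance |l| leads to |l| < |l|. *)
  destruct (Hl (Rabs l) (Rabs_pos_lt _ H0)) as [delta Hd].
  assert (Hxy : 0 < Rabs (y - x)) by (apply Rabs_pos_lt; lra).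
  assert (Hdelta := cond_pos delta).
  (* Moving from [x] by the fraction [r] of the way to [y] stays in [I], as r <= 1, and within delta
     / 2 of [x]. *)
  set (r := Rmin 1 (delta / (2 * Rabs (y - x)))).
  assert (Hr0 : 0 < r).
  { unfold r; apply Rmin_glb_lt; [lra|].
    apply Rdiv_lt_0_compat; lra. }
  assert (Hr1 : r <= 1) by apply Rmin_l.
  assert (Hrd : r * Rabs (y - x) <= delta / 2).
  { replace (delta / 2) with (delta / (2 * Rabs (y - x)) * Rabs (y - x))
      by (field; lra).
    apply Rmult_le_compat_r; [lra|apply Rmin_r]. }
  assert (Ih : I (x + r * (y - x))).
  { destruct (Rle_lt_dec x y) as [Hle|Hlt].
    - apply (HI x y); [assumption..|split; nra].
    - apply (HI y x); [assumption..|split; nra]. }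
  assert (Hh0 : r * (y - x) <> 0) by (apply Rmult_integral_contrapositive; lra).
  specialize (Hd (r * (y - x)) Hh0).
  rewrite (Hf _ Ih), (Hf _ Ix) in Hd.
  replace ((k - k) / (r * (y - x)) - l) with (- l) in Hd by (field; lra).
  rewrite Rabs_Ropp in Hd.
  apply (Rlt_irrefl (Rabs l)), Hd.
  rewrite Rabs_mult, (Rabs_right r); lra.
Qed.

(** * The frame of a ruled surface *)

Lemma ldot_frame_g_ruling (X : ruled_surface) (s : R) :
  ldot (frame_g X s) (ruling X s) = 0.
Proof. unfold frame_g, ldot, vopp, vscal, lcross; simpl; ring. Qed.

(** The sign in [frame_g] cancels that of [lcross]. With a = c' this turns Delta into <c', g>. *)
Lemma ldot_frame_g (X : ruled_surface) (s : R) (a : vec3) :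
  ldot a (frame_g X s) = det3 a (ruling X s) (frame_t X s).
Proof. unfold frame_g, ldot, vopp, vscal, lcross, det3; simpl; ring. Qed.

Lemma is_vderive_frame_g (I : R -> Prop) (X : ruled_surface) (s : R) :
  vsmooth_on I (ruling X) -> I s -> exists l, is_vderive (frame_g X) s l.
Proof.
  intros HX Is; eexists; apply is_vderive_opp_lcross.
  - eapply vsmooth_on_is_vderive; eassumption.
  - eapply vsmooth_on_is_vderive_vderive; eassumption.
Qed.

(** Differentiate <e, e> = 1. The point [y] rules out a one-point domain, on which constancy says
    nothing about the derivative. *)
Lemma ldot_ruling_frame_t (X : ruled_surface) (s y : R) :
  spacelike_ruled X -> dom X s -> dom X y -> y <> s ->
  ldot (ruling X s) (frame_t X s) = 0.
Proof.
  intros HX Hs Hy Hys.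
  assert (De := vsmooth_on_is_vderive _ _ _ (sr_ruling_smooth X HX) Hs).
  assert (H := is_derive_const_on_interval _ _ _ _ _ _ (sr_interval X HX)
    Hs Hy Hys (sr_ruling_unit X HX) (is_derive_ldot _ _ _ _ _ De De)).
  change (vderive (ruling X) s) with (frame_t X s) in H.
  rewrite (ldot_sym (frame_t X s)) in H; lra.
Qed.

(** By Lagrange's identity, <g, g> = <e, t>^2 - <e, e><t, t> = 0 - 1 (-1). *)
Lemma ldot_frame_g_frame_g (X : ruled_surface) (s y : R) :
  spacelike_ruled X -> dom X s -> dom X y -> y <> s ->
  ldot (frame_g X s) (frame_g X s) = 1.
Proof.
  intros HX Hs Hy Hys.
  unfold frame_g, vopp; rewrite ldot_vscal_l, ldot_sym, ldot_vscal_l.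
  rewrite ldot_lcross_lcross, (ldot_sym (frame_t X s) (ruling X s)).
  rewrite (ldot_ruling_frame_t X s y), (sr_ruling_unit X HX s),
    (sr_arclength X HX s); auto; ring.
Qed.

Lemma ldot_frame_g_derive (X : ruled_surface) (s y : R) (l : vec3) :
  spacelike_ruled X -> dom X s -> dom X y -> y <> s ->
  is_vderive (frame_g X) s l -> ldot (frame_g X s) l = 0.
Proof.
  intros HX Hs Hy Hys Dg.
  assert (Hgg : forall z, dom X z -> ldot (frame_g X z) (frame_g X z) = 1).
  { intros z Hz; destruct (Req_dec z s) as [->|Hzs].
    - apply (ldot_frame_g_frame_g X s y); assumption.
    - apply (ldot_frame_g_frame_g X z s); auto. }
  assert (H := is_derive_const_on_interval _ _ _ _ _ _ (sr_interval X HX)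
    Hs Hy Hys Hgg (is_derive_ldot _ _ _ _ _ Dg Dg)).
  rewrite (ldot_sym l) in H; lra.
Qed.

(** Equal cross products with the unit vector [g] make a - b parallel to [g], hence orthogonal to
    [l]. Lagrange's identity gives this directly: pairing a x g with l x g yields -<a, l>. *)
Lemma ldot_eq_of_lcross_eq (a b g l : vec3) :
  lcross a g = lcross b g -> ldot g g = 1 -> ldot g l = 0 ->
  ldot a l = ldot b l.
Proof.
  intros Hc Hg Hl.
  assert (Ha := ldot_lcross_lcross a g l g).
  assert (Hb := ldot_lcross_lcross b g l g).
  rewrite Hc, Hb, Hg, Hl in Ha; lra.
Qed.

(** Written as <c', g>, Delta is differentiable. Continuity is what the fundamental theorem of
    calculus asks of the integrand. *)
Lemma continuous_ruled_Delta (I : R -> Prop) (X : ruled_surface) (s : R) :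
  vsmooth_on I (base X) -> vsmooth_on I (ruling X) -> I s ->
  continuous (ruled_Delta X) s.
Proof.
  intros Hc He Is.
  destruct (is_vderive_frame_g I X s He Is) as [l Dg].
  apply (continuous_ext (fun u => ldot (vderive (base X) u) (frame_g X u))).
  { intros u; apply ldot_frame_g. }
  apply (ex_derive_continuous (V := R_NormedModule)); eexists.
  apply is_derive_ldot; [|exact Dg].
  eapply vsmooth_on_is_vderive_vderive; eassumption.
Qed.

(** * Hyperbolic functions, used to recover theta from sinh theta *)

Lemma is_derive_arcsinh (x : R) : is_derive arcsinh x (/ sqrt (x ^ 2 + 1)).
Proof. apply is_derive_Reals, derivable_pt_lim_arcsinh. Qed.

Lemma sqrt_sinh (x : R) : sqrt (sinh x ^ 2 + 1) = cosh x.
Proof.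
  apply sqrt_lem_1; [nra| |].
  - unfold cosh; assert (H := exp_pos x); assert (H' := exp_pos (- x)); lra.
  - assert (H : exp x * exp (- x) = 1).
    { rewrite <- exp_plus, Rplus_opp_r; exact exp_0. }
    unfold cosh, sinh; nra.
Qed.

Lemma cosh_gt_0 (x : R) : 0 < cosh x.
Proof.
  unfold cosh; assert (H := exp_pos x); assert (H' := exp_pos (- x)); lra.
Qed.

Lemma Derive_sinh (x : R) : Derive sinh x = cosh x.
Proof. apply is_derive_unique, is_derive_Reals, derivable_pt_lim_sinh. Qed.

(** * Relations between the two surfaces of a Mannheim offset *)

Section MannheimOffset.

Variables (X X1 : ruled_surface) (sigma theta theta_star : R -> R).
Hypothesis hX : spacelike_ruled X.
Hypothesis hX1 : timelike_ruled X1.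
Hypothesis hM : mannheim_offset X X1 sigma.
Hypothesis htheta : dual_offset_angle X X1 sigma
  (fun s => Dual (theta s) (theta_star s)).

Lemma offset_ruling (s : R) : dom X s ->
  ruling X1 (sigma s) =
    vadd (vscal (sinh (theta s)) (ruling X s))
         (vscal (cosh (theta s)) (frame_t X s)).
Proof.
  intros Hs; exact (f_equal vre (proj1 (htheta s Hs))).
Qed.

Lemma offset_frame_t (s : R) : dom X s -> frame_t X1 (sigma s) = frame_g X s.
Proof.
  intros Hs; exact (eq_sym (f_equal vre (mo_mannheim _ _ _ hM s Hs))).
Qed.

Lemma offset_lcross_base (s : R) : dom X s ->
  lcross (base X1 (sigma s)) (frame_g X s) = lcross (base X s) (frame_g X s).
Proof.
  intros Hs; rewrite <- (offset_frame_t s Hs) at 1.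
  exact (eq_sym (f_equal vdu (mo_mannheim _ _ _ hM s Hs))).
Qed.

Lemma sinh_offset_angle (s y : R) : dom X s -> dom X y -> y <> s ->
  ldot (ruling X1 (sigma s)) (ruling X s) = sinh (theta s).
Proof.
  intros Hs Hy Hys.
  rewrite (offset_ruling s Hs), ldot_vadd_l, !ldot_vscal_l.
  rewrite (ldot_sym (frame_t X s)), (ldot_ruling_frame_t X s y),
    (sr_ruling_unit X hX s); auto; ring.
Qed.

Lemma cosh_offset_angle (s y : R) : dom X s -> dom X y -> y <> s ->
  ldot (ruling X1 (sigma s)) (frame_t X s) = - cosh (theta s).
Proof.
  intros Hs Hy Hys.
  rewrite (offset_ruling s Hs), ldot_vadd_l, !ldot_vscal_l.
  rewrite (ldot_ruling_frame_t X s y), (sr_arclength X hX s); auto; ring.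
Qed.

(** Pairing the dual part of the relation for e1 with e gives cosh theta <c1, g> = cosh theta
    (theta^* + <c, g>), and cosh theta is nonzero. *)
Lemma offset_distance (s y : R) : dom X s -> dom X y -> y <> s ->
  ldot (base X1 (sigma s)) (frame_g X s) - ldot (base X s) (frame_g X s) =
  theta_star s.
Proof.
  intros Hs Hy Hys.
  assert (H := f_equal (fun a => ldot (vdu a) (ruling X s))
    (proj1 (htheta s Hs))).
  simpl in H.
  (* The derivative of cosh may stay unevaluated: its term carries the factor <t, e> = 0. *)
  rewrite Derive_sinh, (offset_ruling s Hs), !ldot_vadd_l, !ldot_vscal_l in H.
  rewrite (ldot_sym (frame_t X s)), (ldot_ruling_frame_t X s y),
    (sr_ruling_unit X hX s) in H by assumption.
  assert (Hc := cosh_gt_0 (theta s)).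
  apply (Rmult_eq_reg_l (cosh (theta s))); [|lra].
  rewrite !ldot_frame_g.
  unfold ldot, lcross, vadd, vscal, det3 in *; simpl in *.
  lra.
Qed.

Lemma is_derive_offset_ruling (s : R) : dom X s ->
  is_vderive (fun u => ruling X1 (sigma u)) s
    (vscal (Derive sigma s) (frame_g X s)).
Proof.
  intros Hs; rewrite <- (offset_frame_t s Hs).
  apply is_vderive_comp.
  - exact (vsmooth_on_is_vderive _ _ _ (tr_ruling_smooth X1 hX1)
      (mo_dom _ _ _ hM s Hs)).
  - apply Derive_correct.
    exact (smooth_on_ex_derive _ _ _ (mo_smooth _ _ _ hM) Hs).
Qed.

Lemma is_derive_offset_angle (s y : R) : dom X s -> dom X y -> y <> s ->
  is_derive (fun u => arcsinh (ldot (ruling X1 (sigma u)) (ruling X u))) s (-1).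
Proof.
  intros Hs Hy Hys.
  assert (De := vsmooth_on_is_vderive _ _ _ (sr_ruling_smooth X hX) Hs).
  assert (H := is_derive_comp _ _ _ _ _ (is_derive_arcsinh _)
    (is_derive_ldot _ _ _ _ _ (is_derive_offset_ruling s Hs) De)).
  eapply eq_rect; [exact H|].
  cbv beta; change (vderive (ruling X) s) with (frame_t X s).
  (* The chain rule value is (sigma' <g, e> + <e1, t>) / cosh theta = - cosh theta / cosh theta. *)
  rewrite (sinh_offset_angle s y), sqrt_sinh, ldot_vscal_l,
    ldot_frame_g_ruling, (cosh_offset_angle s y) by assumption.
  assert (Hc := cosh_gt_0 (theta s)).
  unfold scal; simpl; unfold mult; simpl; field; lra.
Qed.

Lemma is_derive_offset_distance (s y : R) : dom X s -> dom X y -> y <> s ->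
  is_derive (fun u => ldot (base X1 (sigma u)) (frame_g X u)
                      - ldot (base X u) (frame_g X u)) s (- ruled_Delta X s).
Proof.
  intros Hs Hy Hys.
  assert (Dc := vsmooth_on_is_vderive _ _ _ (sr_base_smooth X hX) Hs).
  destruct (is_vderive_frame_g _ X s (sr_ruling_smooth X hX) Hs) as [l Dg].
  assert (Dc1 := is_vderive_comp _ _ _ _ _
    (vsmooth_on_is_vderive _ _ _ (tr_base_smooth X1 hX1)
      (mo_dom _ _ _ hM s Hs))
    (Derive_correct _ _
      (smooth_on_ex_derive _ _ _ (mo_smooth _ _ _ hM) Hs))).
  assert (H := is_derive_minus _ _ _ _ _
    (is_derive_ldot _ _ _ _ _ Dc1 Dg) (is_derive_ldot _ _ _ _ _ Dc Dg)).
  eapply eq_rect; [exact H|].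
  rewrite ldot_vscal_l.
  (* Only the [g] paired with the derivative of c1 becomes t1, so that the striction condition of
     [X1] applies. The terms <c1, g'> and <c, g'> then cancel. *)
  rewrite <- (offset_frame_t s Hs) at 1.
  rewrite (tr_striction X1 hX1 (sigma s) (mo_dom _ _ _ hM s Hs)).
  rewrite (ldot_eq_of_lcross_eq (base X1 (sigma s)) (base X s) _ l
    (offset_lcross_base s Hs)
    (ldot_frame_g_frame_g X s y hX Hs Hy Hys)
    (ldot_frame_g_derive X s y l hX Hs Hy Hys Dg)).
  rewrite ldot_frame_g.
  unfold ruled_Delta, minus, plus, opp; simpl; ring.
Qed.

End MannheimOffset.

Theorem theorem5p1 (X X1 : ruled_surface) (sigma : R -> R)
    (theta theta_star : R -> R)
    (hX : spacelike_ruled X) (hX1 : timelike_ruled X1)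
    (hM : mannheim_offset X X1 sigma)
    (htheta : dual_offset_angle X X1 sigma
                (fun s => Dual (theta s) (theta_star s))) :
  exists c c_star : R, forall s, dom X s ->
    theta s = - s + c /\
    theta_star s = - RInt (ruled_Delta X) 0 s + c_star.
Proof.
  exists (theta 0), (theta_star 0); intros s Hs.
  assert (H0 := sr_zero X hX).
  (* The domain could be {0}, so s = 0 is settled directly. Otherwise 0 and [s] are two distinct
     points of it. *)
  destruct (Req_dec s 0) as [->|Hs0].
  { rewrite RInt_point; unfold zero; simpl; split; ring. }
  assert (Hdom : forall u, Rmin 0 s <= u <= Rmax 0 s -> dom X u).
  { intros u Hu.
    apply (sr_interval X hX (Rmin 0 s) (Rmax 0 s)); [| |exact Hu].
    - unfold Rmin; destruct Rle_dec; assumption.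
    - unfold Rmax; destruct Rle_dec; assumption. }
  assert (Hother : forall u, exists y, dom X y /\ y <> u).
  { intros u; destruct (Req_dec u 0) as [->|Hu]; [exists s|exists 0]; auto. }
  assert (Hangle : is_RInt (fun _ => -1) 0 s (theta s - theta 0)).
  { rewrite <- (arcsinh_sinh (theta s)), <- (arcsinh_sinh (theta 0)).
    rewrite <- (sinh_offset_angle X X1 sigma theta theta_star hX htheta s 0),
      <- (sinh_offset_angle X X1 sigma theta theta_star hX htheta 0 s) by auto.
    apply (is_RInt_derive (V := R_CompleteNormedModule)
      (fun u => arcsinh (ldot (ruling X1 (sigma u)) (ruling X u)))).
    - intros u Hu; destruct (Hother u) as [y [Hy Hyu]].
      apply (is_derive_offset_angle X X1 sigma theta theta_star hX hX1 hM htheta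
        u y); auto.
    - intros u _; apply continuous_const. }
  assert (Hdist : is_RInt (fun u => - ruled_Delta X u) 0 s
    (theta_star s - theta_star 0)).
  { rewrite <- (offset_distance X X1 sigma theta theta_star hX htheta s 0),
      <- (offset_distance X X1 sigma theta theta_star hX htheta 0 s) by auto.
    apply (is_RInt_derive (V := R_CompleteNormedModule)
      (fun u => ldot (base X1 (sigma u)) (frame_g X u)
                - ldot (base X u) (frame_g X u))).
    - intros u Hu; destruct (Hother u) as [y [Hy Hyu]].
      apply (is_derive_offset_distance X X1 sigma hX hX1 hM u y); auto.
    - intros u Hu; apply (continuous_opp (V := R_NormedModule)).
      exact (continuous_ruled_Delta _ X u (sr_base_smooth X hX)
        (sr_ruling_smooth X hX) (Hdom u Hu)). }
  split.
  - assert (H := is_RInt_unique _ _ _ _ Hangle).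
    rewrite RInt_const in H; unfold scal in H; simpl in H; unfold mult in H;
      simpl in H; lra.
  - assert (H := is_RInt_opp _ _ _ _ Hdist).
    apply (is_RInt_ext _ (ruled_Delta X)) in H.
    + rewrite (is_RInt_unique _ _ _ _ H); unfold opp; simpl; ring.
    + intros u _; unfold opp; simpl; ring.
Qed.
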